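(* Let $(L,\le)$ be a dual algebraic coframe such that $\mathcal{K}(L,\le)$ has a choice function. For every $x\in L$, $\delta(x)=\delta^+(x)$.
   Context: A filtered set is a nonempty poset in which any two elements have a common lower bound. An element $x$ of a poset $(L,\le)$ is dually compact if for every filtered $F\subset L$ having an infimum with $\bigwedge F\le x$ there is $f\in F$ with $f\le x$; $\mathcal{K}(L,\le)$ is the set of dually compact elements. A dual algebraic lattice is a lattice in which every subset has an infimum and every $x$ equals $\bigwedge F_x$ for some filtered $F_x\subset\mathcal{K}(L,\le)$. A coframe is a lattice in which every subset has an infimum and $x\vee\bigwedge_{s\in S}s=\bigwedge_{s\in S}(x\vee s)$ for all $x\in L$, $S\subset L$. A dual algebraic coframe is both. A choice function of a set $S$ is a map $\theta:\mathcal{P}(S)\setminus\{\emptyset\}\to S$ with $\theta(P)\in P$ for all $P$. $\mathcal{M}(x)$ is the set of maximal elements of $\{z\in L: z<x\}$; $\mu(x):=\bigwedge\mathcal{M}(x)$ if $\mathcal{M}(x)\ne\emptyset$, and $\mu(x):=x$ otherwise. Define $x^{(0)}:=x$, $x^{(\alpha+1)}:=\mu(x^{(\alpha)})$, and $x^{(\lambda)}:=\bigwedge_{\alpha<\lambda}x^{(\alpha)}$ for limit $\lambda$. $\mathtt{r}(x)$ is the least ordinal $\alpha$ with $x^{(\alpha)}=x^{(\alpha+1)}$, and $\mathtt{c}(x):=x^{(\mathtt{r}(x))}$. For $y\le x$, $x-y:=\bigwedge\{w\in L: w\le x,\ y\vee w=x\}$. The strata of $x$ are $\mathtt{s}_\alpha(x):=\{x^{(\alpha)}-m: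 m\in\mathcal{M}(x^{(\alpha)})\}$, and the boundary poset is $\delta(x):=\bigcup_\alpha\mathtt{s}_\alpha(x)$. $\mathcal{I}(L,\le)$ is the set of $s\in L$ such that $|\mathcal{M}(s)|=1$ and every $z<s$ satisfies $z\le\mu(s)$. $\delta^+(x)$ is the set of $s\in\mathcal{I}(L,\le)$ such that $s\le x$ and $s\not\le\mathtt{c}(x)$. *)

(* Defs.v *)
From HB Require Import structures.
From mathcomp Require Import all_boot all_order.
From mathcomp Require Import boolp classical_sets.

Set Implicit Arguments.
Unset Strict Implicit.
Unset Printing Implicit Defensive.

Import Order.TTheory.
Local Open Scope classical_set_scope.
Local Open Scope order_scope.

(* [OSup f] denotes the least ordinal strictly above every [f i], that is
   sup_i (f i + 1).  Every ordinal has this form, being the least strict upper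
   bound of its elements, but the same ordinal has many presentations: ordinals
   are compared with [ole] and [olt], and are equal when [ole] holds both ways. *)
Inductive Ord : Type := OSup (I : Type) (f : I -> Ord).

Fixpoint ole (a b : Ord) {struct a} : Prop :=
  match a, b with
  | OSup _ f, OSup _ g => forall i, exists j, ole (f i) (g j)
  end.

Definition olt (a b : Ord) : Prop :=
  match b with OSup _ g => exists j, ole a (g j) end.

Definition ozero : Ord := OSup (fun i : False => match i with end).
Definition osucc (a : Ord) : Ord := OSup (fun _ : unit => a).

Definition ois_zero (a : Ord) : Prop := forall b, ~ olt b a.
Definition ois_succ (b a : Ord) : Prop :=
  olt b a /\ forall c, olt c a -> ole c b.
Definition ois_limit (a : Ord) : Prop :=
  ~ ois_zero a /\ ~ exists b, ois_succ b a.

Lemma ole_refl a : ole a a.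
Proof. by elim: a => I f IH i; exists i; exact: IH. Qed.

Lemma ole_trans b a c : ole a b -> ole b c -> ole a c.
Proof.
elim: a b c => I f IH [J g] [K h] ab bc i.
by have [j fg] := ab i; have [k gh] := bc j; exists k; apply: IH fg gh.
Qed.

Lemma ole_lt_trans b a c : ole a b -> olt b c -> olt a c.
Proof. by case: c => K h ab [k bk]; exists k; apply: ole_trans ab bk. Qed.

Lemma olt_le_trans b a c : olt a b -> ole b c -> olt a c.
Proof.
case: b c => [J g] [K h] [j aj] bc; have [k jk] := bc j.
by exists k; apply: ole_trans aj jk.
Qed.

Lemma olt_wf : well_founded olt.
Proof.
suff H a : forall b, ole b a -> Acc olt b by move=> a; exact: (H a a (ole_refl a)).
elim: a => I f IH b ba; constructor=> c /olt_le_trans/(_ ba)[i ci].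
exact: IH ci.
Qed.

Lemma olt_irr a : ~ olt a a.
Proof. by elim/(well_founded_ind olt_wf): a => a IH aa; apply: (IH a). Qed.

Lemma oltW a b : olt a b -> ole a b.
Proof.
elim: a b => I f IH [J g] [j fj] i; exists j.
apply: IH; apply: olt_le_trans fj; exists i; exact: ole_refl.
Qed.

Lemma ole_sup J (g : J -> Ord) b : (forall j, olt (g j) b) -> ole (OSup g) b.
Proof. by case: b. Qed.

Lemma ole_total a b : ole a b \/ olt b a.
Proof.
elim: a b => I f IHa b; elim: b => J g IHb.
have [|/existsNP[i ni]] := EM (forall i, exists j, ole (f i) (g j)).
  by left.
right; exists i; apply: ole_sup => j; have [ij|//] := IHa i (g j).
by case: ni; exists j.
Qed.

Lemma ois_succ_osucc a : ois_succ a (osucc a).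
Proof. by split=> [|c []]//; exists tt; exact: ole_refl. Qed.

Section Lattice.
Variables (d : Order.disp_t) (L : latticeType d).
Implicit Types (x y z m s w : L) (S F P : set L).

Definition filtered F : Prop :=
  F !=set0 /\
  forall a b, F a -> F b -> exists c, [/\ F c, c <= a & c <= b].

Definition dually_compact : set L :=
  [set x | forall F i, filtered F -> infimums F i -> i <= x ->
     exists2 f, F f & f <= x].

Definition complete : Prop := forall S, infimums S !=set0.

Definition dual_algebraic_lattice : Prop :=
  complete /\
  forall x, exists F, [/\ filtered F, F `<=` dually_compact & infimums F x].

Definition coframe : Prop :=
  complete /\
  forall x S i, infimums S i ->
    infimums [set x `|` s | s in S] (x `|` i).

Definition dual_algebraic_coframe : Prop :=
  dual_algebraic_lattice /\ coframe.

Definition has_choice_function S : Prop :=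
  exists theta : set L -> L, forall P, P `<=` S -> P !=set0 -> P (theta P).

(* [infimum x0 S] is a library function that returns [x0] when [S] is empty or
   has no infimum; all the uses below concern nonempty sets. *)

Definition maxbelow x : set L :=
  [set m | m < x /\ forall z, z < x -> m <= z -> z = m].

Definition mu x : L :=
  if pselect (maxbelow x !=set0) then infimum x (maxbelow x) else x.

Definition iterate_step x (a : Ord) (rec : forall b, olt b a -> L) : L :=
  if pselect (ois_zero a) then x else
  match pselect (exists b, ois_succ b a) with
  | left h => mu (rec (projT1 (cid h)) (proj1 (projT2 (cid h))))
  | right _ => infimum x [set y | exists b (ba : olt b a), y = rec b ba]
  end.

Definition iterate x : Ord -> L := Fix olt_wf (fun=> L) (@iterate_step x).

Definition is_rank x (a : Ord) : Prop :=
  iterate x a = iterate x (osucc a) /\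
  forall b, iterate x b = iterate x (osucc b) -> ole a b.

(* The default value is never used in a complete lattice, see [rankP]. *)
Definition rank x : Ord :=
  match pselect (exists a, is_rank x a) with
  | left h => projT1 (cid h)
  | right _ => ozero
  end.

Definition core x : L := iterate x (rank x).

(* [lminus x y] is x - y; it is only meaningful for [y <= x]. *)
Definition lminus x y : L := infimum x [set w | w <= x /\ y `|` w = x].

Definition stratum (a : Ord) x : set L :=
  [set lminus (iterate x a) m | m in maxbelow (iterate x a)].

Definition boundary x : set L := [set s | exists a : Ord, stratum a x s].

Definition irreducibles : set L :=
  [set s | (exists m, maxbelow s = [set m]) /\ forall z, z < s -> z <= mu s].

Definition boundary_plus x : set L :=
  [set s | [/\ irreducibles s, s <= x & ~~ (s <= core x)]].

Lemma iterateE x a :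
  iterate x a = iterate_step x (fun b (_ : olt b a) => iterate x b).
Proof.
rewrite /iterate Fix_eq // => c f g fg; suff -> : f = g by [].
by do 2![apply: functional_extensionality_dep => ?].
Qed.

Lemma iterate_zero x a : ois_zero a -> iterate x a = x.
Proof. by move=> a0; rewrite iterateE /iterate_step; case: pselect. Qed.

Lemma iterate_limit x a : ois_limit a ->
  iterate x a = infimum x [set y | exists2 b, olt b a & y = iterate x b].
Proof.
case=> a0 aS; rewrite iterateE /iterate_step.
case: (pselect (ois_zero a)) => [//|?].
case: (pselect (exists b, ois_succ b a)) => [//|?]; congr infimum.
by apply/seteqP; split=> [y [b [ba ->]]|y [b ba ->]]; [exists b|exists b, ba].
Qed.

Lemma iterate_eqv x a b : ole a b -> ole b a -> iterate x a = iterate x b.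
Proof.
elim/(well_founded_ind olt_wf): a b => a IH b ab ba.
have lab c : olt c a <-> olt c b.
  by split=> /olt_le_trans; exact.
have sab c : ois_succ c a <-> ois_succ c b.
  by rewrite /ois_succ; split=> -[/lab ? H]; split=> // e /lab /H.
have zab : ois_zero a <-> ois_zero b by split=> H c /lab; exact: H.
have [a0|a0] := EM (ois_zero a).
  by rewrite !iterate_zero//; apply/zab.
have [[c ca]|aS] := EM (exists c, ois_succ c a).
  rewrite !iterateE /iterate_step; case: (pselect (ois_zero a)) => [//|?].
  case: (pselect (ois_zero b)) => [/zab//|?].
  case: pselect => [h|nh]; last by case: nh; exists c.
  case: pselect => [h'|nh]; last by case: nh; exists c; apply/sab.
  case: (cid h) => u [ua Hu] /=; case: (cid h') => v [vb Hv] /=.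
  by congr mu; apply: IH => //; [apply/Hv/lab|apply/Hu/lab].
rewrite !iterate_limit//; last first.
  by split; [move/zab|case=> c /sab ca; apply: aS; exists c].
by congr infimum; apply/seteqP; split=> y /= [c /lab ca ->]; exists c.
Qed.

Lemma iterate_succ x b a : ois_succ b a -> iterate x a = mu (iterate x b).
Proof.
move=> ba; rewrite iterateE /iterate_step; case: (pselect (ois_zero a)) => [a0|?].
  by case: (a0 b); case: ba.
case: pselect => [h|nh]; last by case: nh; exists b.
case: (cid h) => u [ua Hu] /=; case: ba => ba Hb.
by congr mu; apply: iterate_eqv; [exact: Hb|exact: Hu].
Qed.

Lemma iterate_osucc x a : iterate x (osucc a) = mu (iterate x a).
Proof. exact/iterate_succ/ois_succ_osucc. Qed.

Lemma infimum_le S x y : complete -> S y -> infimum x S <= y.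
Proof.
move=> cL Sy; rewrite /infimum; case: ifP => [/eqP S0|_].
  by move: Sy; rewrite S0.
by have [i Si] := cL S; have [/(_ y Sy)] := xgetPex x (ex_intro _ i Si).
Qed.

Lemma mu_le x : complete -> mu x <= x.
Proof.
rewrite /mu => cL; case: pselect => [[m mx]|//].
have := @infimum_le (maxbelow x) x m cL mx => /le_trans; apply.
by case: mx => /ltW.
Qed.

Lemma iterate_anti x a b : complete -> ole a b -> iterate x b <= iterate x a.
Proof.
move=> cL; elim/(well_founded_ind olt_wf): b a => b IH a ab.
have [ba|ltab] := ole_total b a; first by rewrite (@iterate_eqv _ a b).
have [b0|b0] := EM (ois_zero b); first by case: (b0 a).
have [[c [cb Hc]]|bS] := EM (exists c, ois_succ c b).
  rewrite (@iterate_succ _ c)//; apply: le_trans (mu_le _ cL) _.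
  by apply: IH => //; exact: Hc.
by rewrite iterate_limit//; apply: infimum_le => //; exists a.
Qed.

(* If the sequence never stabilised, it would be injective, and the ordinal
   [OSup f] with [f] a left inverse of it would be greater than itself. *)
Lemma rank_exists x : complete -> exists a, is_rank x a.
Proof.
move=> cL.
suff [a Ha] : exists a, iterate x a = iterate x (osucc a).
  elim/(well_founded_ind olt_wf): a Ha => a IH Ha.
  have [[b [ba Hb]]|H] :=
    EM (exists b, olt b a /\ iterate x b = iterate x (osucc b)).
    exact: IH ba Hb.
  exists a; split=> // b Hb; have [//|ba] := ole_total a b.
  by case: H; exists b.
apply: contrapT => /forallNP st.
have inj a b : iterate x a = iterate x b -> ole a b.
  move=> ab; have [//|ba] := ole_total a b; case: (st b).
  apply/le_anti; rewrite -{1}ab !iterate_anti//.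
    by case: (ois_succ_osucc b) => /oltW.
  by case: (a) ba => I f [i bi] _; exists i.
have [f fP] : exists f : L -> Ord, forall a, ole a (f (iterate x a)).
  have H y : exists b, forall a, iterate x a = y -> ole a b.
    have [[b <-]|H] := EM (exists b, iterate x b = y).
      by exists b => a /inj.
    by exists ozero => a ay; case: H; exists a.
  by have [f fP] := choice H; exists f => a; exact: fP.
apply: (@olt_irr (OSup f)).
by exists (iterate x (OSup f)); exact: fP.
Qed.

Lemma rankP x : complete -> is_rank x (rank x).
Proof.
move=> cL; rewrite /rank; case: pselect => [h|]; first by case: cid.
by case; exact: rank_exists.
Qed.

End Lattice.

Arguments dually_compact {d} L.
Arguments complete {d} L.
Arguments dual_algebraic_lattice {d} L.
Arguments coframe {d} L.
Arguments dual_algebraic_coframe {d} L.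
Arguments irreducibles {d} L.

(* Main.v *)
Require Import Defs.
From mathcomp Require Import all_boot all_order.
From mathcomp Require Import boolp classical_sets.

(** The equality rests on two facts about a single element [z] with a maximal
    strict minorant [m].  Since a coframe has a least [w] with [m `|` w = z],
    namely [z - m], anything strictly below [z - m] fails to complement [m] and
    hence, by maximality of [m], lies below [m]; so [m `&` (z - m)] is the
    greatest element strictly below [z - m], which is therefore irreducible
    ([lminus_irreducible]).  Conversely an irreducible [s <= z] that is not
    below [m] satisfies [m `|` s = z], so [z - m <= s]; a strict inequality
    would write [s] as the join of [z - m] and [s `&` m], both strictly below
    [s], against irreducibility ([irreducible_eq_lminus]).

    It remains to locate the right level.  The core lies below every iterate
    ([core_le_iterate]), so an element not below [mu (iterate x a)] is not below
    the core.  Conversely an element below [x] but not below the core leaves the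
    decreasing chain of iterates at a first ordinal, which is neither zero nor,
    as infima are taken at limits, a limit; it thus lies below some
    [iterate x a] but not below [mu (iterate x a)] ([exists_exit_stage]), and
    hence is not below some maximal strict minorant of [iterate x a]. *)

Set Implicit Arguments.
Unset Strict Implicit.
Unset Printing Implicit Defensive.

Import Order.TTheory.
Local Open Scope classical_set_scope.
Local Open Scope order_scope.

Section Boundary.
Variables (d : Order.disp_t) (L : latticeType d).
Implicit Types (x y z m s t w : L) (S : set L) (a b : Ord).

Lemma infimum_infimums S x : complete L -> S !=set0 ->
  infimums S (infimum x S).
Proof.
move=> cL /set0P S0; rewrite /infimum (negbTE S0).
by have [i Si] := cL S; exact: (xgetPex x (ex_intro _ i Si)).
Qed.

Lemma le_infimum S x y : complete L -> S !=set0 ->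
  (forall s, S s -> y <= s) -> y <= infimum x S.
Proof.
by move=> cL S0 yS; have [_] := infimum_infimums x cL S0; apply=> s /yS.
Qed.

Lemma coframe_joinIr x y z : coframe L ->
  x `|` (y `&` z) = (x `|` y) `&` (x `|` z).
Proof.
have infimums2 (u v : L) : infimums [set u; v] (u `&` v).
  split=> [c|c cuv]; first by case=> ->; [exact: leIl|exact: leIr].
  by rewrite lexI !cuv//; [right|left].
move=> [_ cfL]; have H := cfL x _ _ (infimums2 y z).
by apply: is_subset1_infimums H _; rewrite image_setU !image_set1; exact: infimums2.
Qed.

Lemma mu_maxbelow1 s m : complete L -> maxbelow s = [set m] -> mu s = m.
Proof.
move=> cL sm; have sm0 : maxbelow s !=set0 by rewrite sm; exists m.
rewrite /mu; case: pselect => //= _.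
by have := infimum_infimums s cL sm0; rewrite sm infimums1.
Qed.

Lemma maxbelow_join z m y : maxbelow z m -> y <= z -> ~~ (y <= m) ->
  m `|` y = z.
Proof.
move=> [mz mmax] yz ym; apply/eqP; apply: contraNT ym => ne.
rewrite -(mmax (m `|` y)) ?leUr ?leUl//.
by rewrite lt_neqAle ne leUx (ltW mz).
Qed.

Section Lminus.
Variables z m : L.
Hypotheses (cfL : coframe L) (mz : m <= z).

Lemma lminus_infimums :
  infimums [set w | w <= z /\ m `|` w = z] (lminus z m).
Proof.
by apply: infimum_infimums cfL.1 _; exists z; split=> //; exact: join_r.
Qed.

Lemma lminus_le w : w <= z -> m `|` w = z -> lminus z m <= w.
Proof. by move=> wz mwz; apply: lminus_infimums.1. Qed.

Lemma lminus_lel : lminus z m <= z.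
Proof. by apply: lminus_le => //; exact: join_r. Qed.

(** The coframe law makes the infimum defining [z - m] a minimum: joining with
    [m] turns the family of complements into the constant [z]. *)
Lemma join_lminus : m `|` lminus z m = z.
Proof.
have H := cfL.2 m _ _ lminus_infimums; apply: is_subset1_infimums H _.
split=> [c [w [_ ->] <-]//|c]; apply; exists z; last exact: join_r.
by split=> //; exact: join_r.
Qed.

End Lminus.

Lemma lminus_nle z m : coframe L -> m < z -> ~~ (lminus z m <= m).
Proof.
move=> cfL mz; apply/negP => /join_l.
by rewrite (join_lminus cfL (ltW mz)) => E; rewrite E ltxx in mz.
Qed.

(** Everything strictly below [z - m] fails to complement [m] in [z], so it
    lies below [m] by maximality: [m `&` (z - m)] is the greatest element
    strictly below [z - m]. *)
Lemma lminus_irreducible z m : coframe L -> maxbelow z m ->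
  irreducibles L (lminus z m).
Proof.
move=> cfL mM; have mz : m < z by case: mM.
set s := lminus z m; have sz : s <= z := lminus_lel cfL (ltW mz).
have lt_sm t : t < s -> t <= m `&` s.
  move=> ts; have tz : t <= z := le_trans (ltW ts) sz.
  rewrite lexI (ltW ts) andbT; apply: contraLR ts => tm.
  by rewrite le_gtF// (lminus_le cfL (ltW mz) tz)// (maxbelow_join mM).
have ms : m `&` s < s.
  by rewrite lt_neqAle leIr andbT eq_meetr lminus_nle.
have maxs : maxbelow s = [set m `&` s].
  apply/seteqP; split=> [t [ts tmax]|_ ->] /=.
    by rewrite (tmax (m `&` s))// lt_sm.
  by split=> // t ts mst; apply/le_anti; rewrite mst lt_sm.
split; first by exists (m `&` s).
by move=> t ts; rewrite (mu_maxbelow1 cfL.1 maxs) lt_sm.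
Qed.

(** Distributivity gives [s = (z - m) `|` (s `&` m)], and an irreducible
    element is not a join of two strictly smaller ones. *)
Lemma irreducible_eq_lminus z m s : coframe L -> maxbelow z m ->
  irreducibles L s -> s <= z -> ~~ (s <= m) -> lminus z m = s.
Proof.
move=> cfL mM [[p sp] s_mu] sz sm; have mz : m < z by case: mM.
set w := lminus z m.
have ws : w <= s by rewrite (lminus_le cfL (ltW mz) sz)// (maxbelow_join mM).
apply/eqP; apply: contraT => nws.
have w_mu : w <= mu s by rewrite s_mu// lt_neqAle nws.
have sm_mu : s `&` m <= mu s.
  by rewrite s_mu// lt_neqAle leIl andbT eq_meetl.
have mus : mu s < s.
  have [ps _] : maxbelow s p by rewrite sp.
  by rewrite (mu_maxbelow1 cfL.1 sp).
have : w `|` (s `&` m) = s.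
  rewrite coframe_joinIr// (join_r ws) [w `|` m]joinC.
  by rewrite join_lminus ?ltW// meet_l.
by move=> E; move: mus; rewrite le_gtF// -{1}E leUx w_mu.
Qed.

(** The iterates are constant from the rank on, so those past the rank equal the
    core and those before it lie above it. *)
Lemma core_le_iterate x a : complete L -> core x <= iterate x a.
Proof.
move=> cL; have [rfix _] := rankP x cL.
elim/(well_founded_ind olt_wf): a => a IH.
have [ar|ra] := ole_total a (rank x); first exact: iterate_anti.
have [a0|a0] := EM (ois_zero a); first by case: (a0 _ ra).
have [[b [ba Hb]]|aS] := EM (exists b, ois_succ b a).
  suff E : iterate x b = core x.
    by rewrite (@iterate_succ _ _ x b)// E -iterate_osucc -rfix.
  by apply/le_anti; rewrite IH// iterate_anti//; exact: Hb.
rewrite iterate_limit//; apply: le_infimum => //; first by exists (core x), (rank x).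
by move=> _ [b ba ->]; exact: IH.
Qed.

(** An element below all earlier iterates is below their infimum, so the first
    iterate that is not above [s] occurs at a successor. *)
Lemma exists_exit_stage x s : complete L -> s <= x -> ~~ (s <= core x) ->
  exists2 a, s <= iterate x a & ~~ (s <= mu (iterate x a)).
Proof.
move=> cL sx; rewrite /core; elim/(well_founded_ind olt_wf): (rank x) => a IH sa.
have [a0|a0] := EM (ois_zero a); first by rewrite iterate_zero// sx in sa.
have [[b ba]|aS] := EM (exists b, ois_succ b a).
  have [sb|sb] := boolP (s <= iterate x b); last by apply: IH sb; case: ba.
  by exists b => //; rewrite -(iterate_succ x ba).
have [[b ba sb]|nb] := EM (exists2 b, olt b a & ~~ (s <= iterate x b)).
  exact: IH ba sb.
case/negP: sa; rewrite iterate_limit//; apply: le_infimum => //.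
  have [b ba] : exists b, olt b a by apply: contrapT => /forallNP.
  by exists (iterate x b), b.
by move=> _ [b ba ->]; apply: contrapT => /negP sb; case: nb; exists b.
Qed.

Lemma exists_maxbelow_nle z s : complete L -> s <= z -> ~~ (s <= mu z) ->
  exists2 m, maxbelow z m & ~~ (s <= m).
Proof.
move=> cL sz; rewrite /mu; case: pselect => [M0|_] /=; last by rewrite sz.
move=> smu; apply: contrapT => nm; case/negP: smu; apply: le_infimum => // m mM.
by apply: contrapT => /negP sm; apply: nm; exists m.
Qed.

Lemma mu_le_maxbelow z m : complete L -> maxbelow z m -> mu z <= m.
Proof.
rewrite /mu => cL mM; case: pselect => /= [_|[]]; last by exists m.
exact: infimum_le.
Qed.

End Boundary.

Theorem lemma4p24 (d : Order.disp_t) (L : latticeType d)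
    (Lcoframe : dual_algebraic_coframe L)
    (Kchoice : has_choice_function (dually_compact L))
    (x : L) :
  boundary x = boundary_plus x.
Proof.
have [_ cfL] := Lcoframe; have cL : complete L := cfL.1.
apply/seteqP; split=> [_ [a [m mM <-]]|s [sI sx sc]].
  have mz : (m < iterate x a)%O by case: mM.
  split; first exact: lminus_irreducible.
    apply: le_trans (lminus_lel cfL (ltW mz)) _.
    rewrite -[leRHS](@iterate_zero _ _ x ozero); last by move=> b [].
    by apply: iterate_anti => //; case: (a) => J g [].
  apply: contra (lminus_nle cfL mz) => /le_trans; apply.
  apply: le_trans (mu_le_maxbelow cL mM).
  by rewrite -iterate_osucc; exact: core_le_iterate.
have [a sa smu] := exists_exit_stage cL sx sc.
have [m mM sm] := exists_maxbelow_nle cL sa smu.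
by exists a, m => //; exact: irreducible_eq_lminus.
Qed.
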